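(* The Urysohn universal space $(\mathbb{U},\rho)$ satisfies the finite ball intersection property: for any finitely many points $x_1,x_2,\dots,x_n$ in $\mathbb{U}$ and any positive real numbers $r_1,r_2,\dots,r_n$ satisfying $\rho(x_i,x_j)\leq r_i+r_j$ for all $i,j$, we have $\bigcap_{i=1}^{n} B(x_i,r_i)\neq\emptyset$.
   Context: The Urysohn universal space $(\mathbb{U},\rho)$ is the (unique up to isometry) complete separable metric space that contains an isometric image of every separable metric space and has the finite transitivity property: every isometry between finite subsets of $\mathbb{U}$ extends to an isometry of $\mathbb{U}$ onto itself. $B(x,r)=\{y : \rho(x,y)\leq r\}$ denotes the closed ball centered at $x$ with radius $r$. *)

(* Defs.v *)
From HB Require Import structures.
From mathcomp Require Import all_boot all_order all_algebra.
From mathcomp Require Import all_classical all_reals all_analysis.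

Set Implicit Arguments.
Unset Strict Implicit.
Unset Printing Implicit Defensive.

Import Order.TTheory GRing.Theory Num.Theory.

Local Open Scope classical_set_scope.
Local Open Scope ring_scope.

Definition isometry_on (R : realType) (X Y : metricType R) (A : set X)
    (f : X -> Y) : Prop :=
  forall x y, A x -> A y -> mdist (f x) (f y) = mdist x y.

Definition is_isometry (R : realType) (X Y : metricType R) (f : X -> Y) : Prop :=
  isometry_on [set: X] f.

Definition separable_space (T : topologicalType) : Prop :=
  exists2 D : set T, countable D & dense D.

(* Same condition as in the library's [completeType], whose underlying type
   must in addition come with a distinguished point. *)
Definition complete_space (T : uniformType) : Prop :=
  forall F : set_system T, ProperFilter F -> cauchy F -> exists l : T, F --> l.

(* [X] is a [metricType], which may be empty. *)
Definition universal_space (R : realType) (U : metricType R) : Prop :=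
  forall X : metricType R, separable_space X ->
    exists f : X -> U, is_isometry f.

(* An isometry of [A] onto [B] is given by a total function of which only the
   values on [A] are relevant. *)
Definition finitely_transitive (R : realType) (U : metricType R) : Prop :=
  forall (A B : set U) (f : U -> U),
    finite_set A -> finite_set B -> f @` A = B -> isometry_on A f ->
    exists g : U -> U,
      [/\ is_isometry g, g @` [set: U] = [set: U] & {in A, g =1 f}].

(* These properties determine [U] up to isometry. *)
Record urysohn_space (R : realType) (U : metricType R) : Prop := UrysohnSpace {
  urysohn_complete : complete_space U;
  urysohn_separable : separable_space U;
  urysohn_universal : universal_space U;
  urysohn_transitive : finitely_transitive U
}.

(* Not the library's [closed_ball], which is the closure of the open ball and
   can be strictly smaller in a general metric space. *)
Definition cball (R : realType) (X : metricType R) (x : X) (r : R) : set X :=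
  [set y | mdist x y <= r].

Definition finite_ball_intersection_property (R : realType) (X : metricType R)
    : Prop :=
  forall (n : nat) (x : 'I_n -> X) (r : 'I_n -> R),
    (forall i, 0 < r i) ->
    (forall i j, mdist (x i) (x j) <= r i + r j) ->
    \bigcap_(i in [set: 'I_n]) cball (x i) (r i) !=set0.

(* Main.v *)
Require Import Defs.
From HB Require Import structures.
From mathcomp Require Import all_boot all_order all_algebra.
From mathcomp Require Import all_classical all_reals all_analysis.

(** The ball intersection property is first obtained in the space of [n]-vectors
    with the sup norm, where balls are products of intervals, so that it comes
    down to the fact that pairwise intersecting intervals of a line have a
    common point ([rV_finite_ball_intersection]).  It passes to the Urysohn
    space because finite configurations can be carried back and forth.  The map
    sending a point to its vector of distances to [x_1], ..., [x_n] preserves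
    the distances between the [x_i] ([kuratowski_isometry]), so the balls of
    radii [r_i] around the image vectors have a common point [z].  Sup-norm
    space is separable, hence universality embeds it, together with [z], in the
    Urysohn space.  The images of the vectors of the [x_i] then form a copy of
    the configuration of the [x_i], which finite transitivity moves back onto
    the [x_i] by a global isometry ([isometry_matching_family]); the image of
    [z] under that isometry lies in all the given balls. *)

Set Implicit Arguments.
Unset Strict Implicit.
Unset Printing Implicit Defensive.

Import Order.TTheory GRing.Theory Num.Theory.
Import numFieldNormedType.Exports.

Local Open Scope classical_set_scope.
Local Open Scope ring_scope.

(** Universality speaks of metric types, so matrices, which are already a
    pseudometric type whose balls are those of the sup norm, are given the
    distance of that norm. *)
Section matrix_metric.
Variables (K : realFieldType) (m n : nat).
Let mx_dist (u v : 'M[K]_(m, n)) : K := `|u - v|.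

Let mx_dist_ge0 u v : 0 <= mx_dist u v.
Proof. exact: normr_ge0. Qed.

Let mx_dist_positivity u v : mx_dist u v = 0 -> u = v.
Proof. by move/normr0_eq0/eqP; rewrite subr_eq0 => /eqP. Qed.

Let mx_ball_dist u e : ball u e = [set v | mx_dist u v < e].
Proof. by rewrite -ball_normE. Qed.

HB.instance Definition _ := PseudoMetric_isMetric.Build K 'M[K]_(m, n)
  mx_dist_ge0 mx_dist_positivity mx_ball_dist.

Lemma mdist_mxE (u v : 'M[K]_(m, n)) : mdist u v = `|u - v|.
Proof. by []. Qed.

End matrix_metric.

Lemma mdist_rV_le (R : realType) (n : nat) (u v : 'rV[R]_n) (e : R) :
  0 <= e -> (mdist u v <= e) <-> (forall k, `|u ord0 k - v ord0 k| <= e).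
Proof.
move=> e0; rewrite mdist_mxE [X in X <= _]mx_normrE; split.
  move=> /bigmax_leP[_ uv] k; have := uv (ord0, k) isT.
  by rewrite !mxE.
move=> uv; apply/bigmax_leP; split=> // -[i k] _ /=.
by rewrite !mxE (ord1 i).
Qed.

(** The vectors with rational coordinates are dense. *)
Lemma separable_rV (R : realType) (n : nat) : separable_space 'rV[R]_n.
Proof.
exists [set map_mx ratr q | q in [set: 'rV[rat]_n]].
  exact: sub_countable (card_image_le _ _) (countableP _).
move=> O [u Ou] oO.
have /nbhs_ballP[e /= e0 ueO] : nbhs u O by apply: open_nbhs_nbhs.
have apx k : {q : rat | `|u ord0 k - ratr q| < e / 2}.
  apply: cid.
  have [||p [uq [q _ qp]]] := @dense_rat R (ball (u ord0 k) (e / 2)).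
  - by exists (u ord0 k); apply: ballxx; rewrite divr_gt0.
  - exact: ball_open.
  by exists q; move: uq; rewrite -ball_normE -qp.
exists (map_mx ratr (\row_k sval (apx k))); split; last first.
  by exists (\row_k sval (apx k)).
apply: ueO; rewrite ballEmdist/=; apply: (@le_lt_trans _ _ (e / 2)).
  apply/mdist_rV_le; first by rewrite divr_ge0// ltW.
  by move=> k; rewrite !mxE; apply/ltW/(svalP (apx k)).
by rewrite ltr_pdivrMr// ltr_pMr// ltr1n.
Qed.

(** Each coordinate asks for a common point of the intervals centred at the
    coordinates of the [x i], of radii [r i].  Their least right end point is
    one: any two of the intervals meet, so no left end point exceeds it. *)
Lemma rV_finite_ball_intersection (R : realType) (m : nat) :
  finite_ball_intersection_property 'rV[R]_m.
Proof.
move=> [|n] x r r0 xr; first by exists 0 => -[].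
pose right_end k i := x i ord0 k + r i.
(* The default value of the minimum is one of its terms. *)
exists (\row_k \big[Order.min/right_end k ord0]_i right_end k i) => i _ /=.
apply/mdist_rV_le; first exact: ltW.
move=> k; rewrite mxE ler_distlC; apply/andP; split.
  have left_le_right j : x i ord0 k - r i <= right_end k j.
    have := xr i j => /mdist_rV_le -/(_ (addr_ge0 (ltW (r0 i)) (ltW (r0 j))) k).
    rewrite ler_distl => /andP[_]; rewrite /right_end lerBlDr.
    by rewrite -addrA [r j + _]addrC.
  exact: le_bigmin.
exact: bigmin_le_cond.
Qed.

(** The coordinates of the Kuratowski embedding at finitely many points: it
    is an isometry on these points, and only 1-Lipschitz elsewhere. *)
Definition kuratowski (R : realType) (X : metricType R) (n : nat)
    (x : 'I_n -> X) (y : X) : 'rV[R]_n :=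
  \row_k mdist y (x k).

(** By the triangle inequality no coordinate of the difference exceeds the
    distance from [x i] to [x j], and the [j]-th coordinate attains it. *)
Lemma kuratowski_isometry (R : realType) (X : metricType R) (n : nat)
    (x : 'I_n -> X) (i j : 'I_n) :
  mdist (kuratowski x (x i)) (kuratowski x (x j)) = mdist (x i) (x j).
Proof.
apply/le_anti/andP; split.
  apply/mdist_rV_le; first exact: mdist_ge0.
  move=> k; rewrite !mxE ler_distl lerBlDr; apply/andP; split.
    by rewrite addrC [mdist (x i) (x j)]metric_sym metric_triangle.
  by rewrite addrC metric_triangle.
set d := mdist (kuratowski x (x i)) _.
have /(mdist_rV_le _ _ (mdist_ge0 _ _)) /(_ j) := lexx d.
by rewrite !mxE mdistxx subr0; exact/le_trans/ler_norm.
Qed.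

(** Finite transitivity for families, which may have repetitions: equality of
    the distances makes [y i |-> x i] a well-defined map on the range of [y]. *)
Lemma isometry_matching_family (R : realType) (U : metricType R) (n : nat)
    (x y : 'I_n -> U) :
  finitely_transitive U ->
  (forall i j, mdist (y i) (y j) = mdist (x i) (x j)) ->
  exists2 g : U -> U, is_isometry g & forall i, g (y i) = x i.
Proof.
move=> trU yx.
have [f fE] : exists f : U -> U, forall i, f (y i) = x i.
  exists (fun p => if pselect (exists i, y i = p) is left e
                   then x (projT1 (cid e)) else p) => i.
  case: pselect => [e|[]]; last by exists i.
  case: cid => j /= yji; apply: mdist_positivity.
  by rewrite -yx yji mdistxx.
have [||||g [giso _ gf]] := trU (range y) (range x) f.
- exact: finite_image.
- exact: finite_image.
- by rewrite image_comp; congr image; apply/funext => i /=.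
- by move=> _ _ [i _ <-] [j _ <-]; rewrite !fE.
by exists g => // i; rewrite gf ?fE// inE; exists i.
Qed.

Theorem theorem3p4 (R : realType) (U : metricType R) (hU : urysohn_space U) :
  finite_ball_intersection_property U.
Proof.
move=> n x r r0 xr; have [_ _ univU trU] := hU.
have [z zP] : \bigcap_(i in [set: 'I_n]) cball (kuratowski x (x i)) (r i) !=set0.
  by apply: rV_finite_ball_intersection => // i j; rewrite kuratowski_isometry.
have [f fiso] := univU _ (@separable_rV R n).
have [g giso gx] : exists2 g : U -> U, is_isometry g &
    forall i, g (f (kuratowski x (x i))) = x i.
  apply: isometry_matching_family => // i j.
  by rewrite fiso// kuratowski_isometry.
exists (g (f z)) => i _; rewrite /cball/= -(gx i) giso// fiso//.
exact: zP.
Qed.
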